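(* There is a hereditary $3$-graph property $\mathcal{H}$ with $\textnormal{SVC}(\mathcal{H})<\infty$ which is far from finite VC-dimension, and constants $C,C'>0$ such that $2^{\epsilon^{-C}}\leq M_{\mathcal{H}}(\epsilon)\leq 2^{\epsilon^{-C'}}$ for all sufficiently small $\epsilon>0$.
   Context: $3$-graphs $H=(V,E)$, $E\subseteq\binom V3$; hereditary $3$-graph properties are classes of finite $3$-graphs closed under isomorphism and induced sub-$3$-graphs. $d_H(X,Y,Z)=|\{(x,y,z)\in X\times Y\times Z:\{x,y,z\}\in E\}|/(|X||Y||Z|)$; a triple $(X,Y,Z)$ is $\epsilon$-regular if $|d_H(X,Y,Z)-d_H(X',Y',Z')|\le\epsilon$ whenever $X'\subseteq X,Y'\subseteq Y,Z'\subseteq Z$ have sizes at least $\epsilon|X|,\epsilon|Y|,\epsilon|Z|$; a partition $\mathcal P$ of $V$ is $\epsilon$-regular if at least $(1-\epsilon)|V|^3$ triples of $V^3$ lie in $X\times Y\times Z$ for some $\epsilon$-regular $(X,Y,Z)\in\mathcal P^3$. $M_{\mathcal H}(\epsilon)$ is the least $M$ such that all sufficiently large members of $\mathcal H$ have an $\epsilon$-regular partition with at most $M$ parts. The VC-dimension of a graph $G$ is the largest $k$ with vertices $a_i$ ($i\in[k]$), $b_S$ ($S\subseteq[k]$) such that $a_ib_S\in E(G)$ iff $i\in S$. For a $3$-graph $H$ and $x\in V$, the slice graph $H_x$ has vertex set $V$ and edges $\{yz: xyz\in E\}$; $\textnormal{SVC}(H)=\max_x \textnormal{VC}(H_x)$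 and $\textnormal{SVC}(\mathcal H)=\sup_{H\in\mathcal H}\textnormal{SVC}(H)$. The VC-dimension of a $3$-graph $H$ is the largest $k$ with vertices $a_1,b_1,\dots,a_k,b_k$ and $c_S$ ($S\subseteq[k]$) such that $a_ib_ic_S\in E$ iff $i\in S$; $\textnormal{VC}(\mathcal H)$ is the supremum over $\mathcal H$. $H=(V,E),H'=(V,E')$ are $\delta$-close if $|\overline E\Delta\overline{E'}|\le\delta|V|^3$ ($\overline E$ the set of ordered triples of edges). $\mathcal H$ is close to $\mathcal H'$ if for all $\delta>0$ there is $N$ such that each $H\in\mathcal H$ on at least $N$ vertices is $\delta$-close to some $H'\in\mathcal H'$ on the same vertex set; $\mathcal H$ is far from finite VC-dimension if it is close to no hereditary $\mathcal H'$ with $\textnormal{VC}(\mathcal H')<\infty$. *)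

(* Defs.v *)
From HB Require Import structures.
From mathcomp Require Import all_boot all_order all_algebra.
From mathcomp Require Import all_classical all_reals all_analysis.
From mathcomp Require Import Rstruct.
Set Implicit Arguments. Unset Strict Implicit. Unset Printing Implicit Defensive.
Import Order.TTheory GRing.Theory Num.Theory.
Local Open Scope ring_scope.

Notation R := Rdefinitions.R.

Definition is3graph (V : finType) (E : {set {set V}}) : Prop :=
  forall e, e \in E -> #|e| = 3%N.

Definition prop3 := forall V : finType, {set {set V}} -> Prop.

(* Pullback of a 3-graph along a map f : W -> V (for injective f this is the
   isomorphic copy, on W, of the sub-3-graph induced on the image of f). *)
Definition pullback (W V : finType) (f : W -> V) (E : {set {set V}}) : {set {set W}} :=
  [set e : {set W} | f @: e \in E].

(* Hereditary: a class of 3-graphs closed under isomorphism and induced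
   sub-3-graphs, i.e. under pullback along injections. *)
Definition hereditary (H : prop3) : Prop :=
  (forall V E, H V E -> is3graph E) /\
  (forall (V W : finType) (f : W -> V) (E : {set {set V}}),
      injective f -> H V E -> H W (pullback f E)).

Definition edge3 (V : finType) (E : {set {set V}}) (x y z : V) : bool :=
  [set x; y; z] \in E.

Definition density (V : finType) (E : {set {set V}}) (X Y Z : {set V}) : R :=
  (#|[set t : V * V * V | [&& t.1.1 \in X, t.1.2 \in Y, t.2 \in Z
                            & edge3 E t.1.1 t.1.2 t.2]]|%:R)
  / ((#|X| * #|Y| * #|Z|)%N%:R).

Definition reg_triple (V : finType) (E : {set {set V}}) (eps : R) (X Y Z : {set V}) : bool :=
  [forall X' : {set V}, [forall Y' : {set V}, [forall Z' : {set V},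
    [&& X' \subset X, Y' \subset Y, Z' \subset Z,
        eps * #|X|%:R <= #|X'|%:R, eps * #|Y|%:R <= #|Y'|%:R
      & eps * #|Z|%:R <= #|Z'|%:R]
    ==> (`|density E X Y Z - density E X' Y' Z'| <= eps)]]].

Definition reg_partition (V : finType) (E : {set {set V}}) (eps : R) (P : {set {set V}}) : Prop :=
  finset.partition P [set: V] /\
  (1 - eps) * (#|V| ^ 3)%N%:R <=
    #|[set t : V * V * V | [exists X in P, exists Y in P, exists Z in P,
          [&& reg_triple E eps X Y Z, t.1.1 \in X, t.1.2 \in Y & t.2 \in Z]]]|%:R.

Definition reg_bound (H : prop3) (eps : R) (M : nat) : Prop :=
  exists N : nat, forall (V : finType) (E : {set {set V}}),
    H V E -> (N <= #|V|)%N ->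
    exists P : {set {set V}}, reg_partition E eps P /\ (#|P| <= M)%N.

Definition is_MH (H : prop3) (eps : R) (M : nat) : Prop :=
  reg_bound H eps M /\ forall M', reg_bound H eps M' -> (M <= M')%N.

Definition graph_shatters (V : finType) (adj : V -> V -> bool) (k : nat) : Prop :=
  exists (a : 'I_k -> V) (b : {set 'I_k} -> V),
    forall (i : 'I_k) (S : {set 'I_k}), adj (a i) (b S) = (i \in S).

Definition slice (V : finType) (E : {set {set V}}) (x : V) : V -> V -> bool :=
  fun y z => [set x; y; z] \in E.

Definition SVC_finite (H : prop3) : Prop :=
  exists d : nat, forall (V : finType) (E : {set {set V}}) (x : V) (k : nat),
    H V E -> graph_shatters (slice E x) k -> (k <= d)%N.

Definition shatters3 (V : finType) (E : {set {set V}}) (k : nat) : Prop :=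
  exists (a b : 'I_k -> V) (c : {set 'I_k} -> V),
    forall (i : 'I_k) (S : {set 'I_k}), ([set a i; b i; c S] \in E) = (i \in S).

Definition VC_finite (H : prop3) : Prop :=
  exists d : nat, forall (V : finType) (E : {set {set V}}) (k : nat),
    H V E -> shatters3 E k -> (k <= d)%N.

Definition delta_close (V : finType) (E E' : {set {set V}}) (delta : R) : Prop :=
  #|[set t : V * V * V | edge3 E t.1.1 t.1.2 t.2 != edge3 E' t.1.1 t.1.2 t.2]|%:R
    <= delta * (#|V| ^ 3)%N%:R.

Definition close (H H' : prop3) : Prop :=
  forall delta : R, 0 < delta -> exists N : nat,
    forall (V : finType) (E : {set {set V}}), H V E -> (N <= #|V|)%N ->
      exists E' : {set {set V}}, H' V E' /\ delta_close E E' delta.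

Definition far_from_finite_VC (H : prop3) : Prop :=
  forall H' : prop3, hereditary H' -> VC_finite H' -> ~ close H H'.

(* Main.v *)
Require Import Defs.
From HB Require Import structures.
From mathcomp Require Import all_boot all_order all_algebra.
From mathcomp Require Import all_classical all_reals all_analysis.
From mathcomp Require Import Rstruct.
From mathcomp Require Import ring lra zify.
Set Implicit Arguments.
Unset Strict Implicit.
Unset Printing Implicit Defensive.
Import Order.TTheory GRing.Theory Num.Theory.
Local Open Scope ring_scope.

(* The property consists of the 3-graphs whose vertices can be labelled by points
   X i, Y i and sets Z s so that the edges are the triples {X i, Y i, Z s} with
   i in s. In a slice, two vertices with a common neighbour are twins, so no slice
   shatters two vertices. Blow-ups of the full structure on k indices shatter k
   pairs, and a random transversal shows that they still do after few edges are
   changed.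

   Lower bound: take the blow-up on k ~ eps^(-1/4) indices with |X| = |Y| = |Z|
   and a regular partition. For each i, almost all z lie in a part on which
   "i in s" is constant up to an eps-fraction, since otherwise most triples in
   X_i * Y_i * {z} would be irregular. As eps is much smaller than 1/k, almost all
   z lie in a part with this property for all i simultaneously; such a part
   contains essentially one set, so about 2^k parts are needed.

   Upper bound: cut the indices, in increasing order, at the multiples of |V|/K of
   their cumulative weight. Separate the last index of each bucket from the other
   ones, and sort the set vertices by the last indices they contain. The only
   triples of parts which are not homogeneous contain two non-last indices from
   the same bucket; there are O(|V|^3/K) such triples of vertices. *)

(** * The 3-graphs *)

Inductive label := LX of nat | LY of nat | LZ of (nat -> bool).

Definition orel (a b c : label) : bool :=
  match a, b, c with
  | LX i, LY j, LZ s => (i == j) && s i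
  | _, _, _ => false
  end.

Definition lrel (a b c : label) : bool :=
  [|| orel a b c, orel a c b, orel b a c, orel b c a, orel c a b | orel c b a].

Definition labelled : prop3 := fun V E =>
  is3graph E /\
  exists f : V -> label, forall x y z, edge3 E x y z = lrel (f x) (f y) (f z).

Lemma lrelC12 a b c : lrel a b c = lrel b a c.
Proof. by case: a => ?; case: b => ?; case: c => ?; rewrite /lrel /= ?orbF. Qed.

Lemma lrelC23 a b c : lrel a b c = lrel a c b.
Proof. by case: a => ?; case: b => ?; case: c => ?; rewrite /lrel /= ?orbF. Qed.

Lemma lrel_eq12 a c : lrel a a c = false.
Proof. by case: a => ?; case: c. Qed.

Lemma lrel_eq13 a b : lrel a b a = false.
Proof. by rewrite lrelC23 lrel_eq12. Qed.

Lemma lrel_eq23 a b : lrel a b b = false.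
Proof. by rewrite lrelC12 lrel_eq13. Qed.

Lemma labelled_hereditary : hereditary labelled.
Proof.
split=> [V E []//|V W g E ginj [E3 [f Ef]]]; split.
  by move=> e; rewrite inE => /E3; rewrite card_imset.
exists (f \o g) => x y z; rewrite /= -Ef /edge3 inE.
by rewrite !imsetU !imset_set1.
Qed.

(** The common neighbour [b] forces [a] and [a'] to be of the same kind and to agree on all that the
    slice at [l] reads: they are the same point, or two sets that both contain the index of [l]. *)
Lemma lrel_twin l a a' b c :
  lrel l a b -> lrel l a' b -> lrel l a c = lrel l a' c.
Proof.
case: l => l; case: b => b; case: a => a //; case: a' => a' //;
  rewrite /lrel /= ?orbF // => /andP[/eqP ea ea1] /andP[/eqP ea' ea1'];
  rewrite /is_true in ea1 ea1';
  case: c => c //=; rewrite ?orbF; subst; try case: eqP => //= ?; subst;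
  congruence.
Qed.

Lemma labelled_SVC : SVC_finite labelled.
Proof.
exists 1%N => V E x k [_ [f Ef]] [a [b ab]]; rewrite leqNgt; apply/negP => k1.
pose i0 := Ordinal (ltnW k1); pose i1 := Ordinal k1.
have adj u v : slice E x u v = lrel (f x) (f u) (f v) by apply: Ef.
(* The full set is a common neighbour of [a i0] and [a i1], so they are twins, yet the vertex of
   [[set i0]] separates them. *)
have i0T : lrel (f x) (f (a i0)) (f (b [set: 'I_k]%SET)).
  by rewrite -adj ab inE.
have i1T : lrel (f x) (f (a i1)) (f (b [set: 'I_k]%SET)).
  by rewrite -adj ab inE.
have := lrel_twin (f (b [set i0]%SET)) i0T i1T.
by rewrite -!adj !ab !inE eqxx.
Qed.

Definition lgraph (V : finType) (f : V -> label) : {set {set V}} :=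
  [set e | [exists x, exists y, exists z,
    (e == [set x; y; z]) && lrel (f x) (f y) (f z)]].

Lemma lgraph_edge3 (V : finType) (f : V -> label) x y z :
  edge3 (lgraph f) x y z = lrel (f x) (f y) (f z).
Proof.
apply/idP/idP => [|xyz]; last first.
  rewrite /edge3 inE; apply/existsP; exists x; apply/existsP; exists y.
  by apply/existsP; exists z; rewrite eqxx.
rewrite /edge3 inE => /existsP[x' /existsP[y' /existsP[z' /andP[/eqP e r]]]].
have : x' \in [set x; y; z] by rewrite e !inE eqxx.
have : y' \in [set x; y; z] by rewrite e !inE eqxx orbT.
have : z' \in [set x; y; z] by rewrite e !inE eqxx orbT.
rewrite !inE -!orbA.
(* Of the 27 cases, those with a repeated vertex contradict [r]; the remaining ones are permutations
   and follow from symmetry. *)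
move=> /or3P[]/eqP z'E /or3P[]/eqP y'E /or3P[]/eqP x'E; move: r; subst;
  rewrite ?lrel_eq12 ?lrel_eq13 ?lrel_eq23 // => r.
- by rewrite lrelC12 lrelC23 lrelC12.
- by rewrite lrelC12 lrelC23.
- by rewrite lrelC23 lrelC12.
- by rewrite lrelC23.
- by rewrite lrelC12.
Qed.

Lemma lgraph_labelled (V : finType) (f : V -> label) : labelled (lgraph f).
Proof.
split; last by exists f; apply: lgraph_edge3.
move=> e; rewrite inE => /existsP[x /existsP[y /existsP[z /andP[/eqP -> r]]]].
rewrite -finset.setUA !cardsU1 cards1 !inE.
have [xy|_] := eqVneq x y; first by rewrite xy lrel_eq12 in r.
have [xz|_] := eqVneq x z; first by rewrite xz lrel_eq13 in r.
by have [yz|_] := eqVneq y z; first by rewrite yz lrel_eq23 in r.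
Qed.

(** * Regular triples and partitions *)

Lemma density_homogeneous (V : finType) (E : {set {set V}}) (X Y Z : {set V})
    (b : bool) :
  (0 < #|X|)%N -> (0 < #|Y|)%N -> (0 < #|Z|)%N ->
  (forall x y z, x \in X -> y \in Y -> z \in Z -> edge3 E x y z = b) ->
  density E X Y Z = b%:R.
Proof.
move=> X0 Y0 Z0 hom; rewrite /density.
have -> : [set t : V * V * V | [&& t.1.1 \in X, t.1.2 \in Y, t.2 \in Z
                            & edge3 E t.1.1 t.1.2 t.2]] =
   if b then finset.setX (finset.setX X Y) Z else finset.set0.
  apply/setP => -[[x y] z]; rewrite !inE /=.
  case: (boolP (x \in X)) => xX; last by case: b {hom}; rewrite !inE /= ?(negPf xX).
  case: (boolP (y \in Y)) => yY; last first.
    by case: b {hom}; rewrite !inE /= ?(negPf yY) ?andbF.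
  case: (boolP (z \in Z)) => zZ; last first.
    by case: b {hom}; rewrite !inE /= ?(negPf zZ) ?andbF.
  by rewrite hom //; case: b {hom}; rewrite !inE /= ?xX ?yY ?zZ.
case: b {hom}; last by rewrite cards0 mul0r.
by rewrite !cardsX divff // pnatr_eq0 -lt0n !muln_gt0 X0 Y0 Z0.
Qed.

(** As [eps] is positive, admissible subsets are nonempty, so all densities compared are the same 0
    or 1. *)
Lemma homogeneous_reg_triple (V : finType) (E : {set {set V}}) (eps : R)
    (X Y Z : {set V}) (b : bool) :
  0 < eps -> (0 < #|X|)%N -> (0 < #|Y|)%N -> (0 < #|Z|)%N ->
  (forall x y z, x \in X -> y \in Y -> z \in Z -> edge3 E x y z = b) ->
  reg_triple E eps X Y Z.
Proof.
move=> e0 X0 Y0 Z0 hom.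
have pos (A A' : {set V}) :
    (0 < #|A|)%N -> eps * #|A|%:R <= #|A'|%:R -> (0 < #|A'|)%N.
  move=> A0 AA'; rewrite -(@ltr_nat R); apply: lt_le_trans AA'.
  by rewrite mulr_gt0 // ltr0n.
apply/forallP => X'; apply/forallP => Y'; apply/forallP => Z'.
apply/implyP => /and5P[/fintype.subsetP sX /fintype.subsetP sY
  /fintype.subsetP sZ /(pos _ _ X0) X0' /andP[/(pos _ _ Y0) Y0' /(pos _ _ Z0) Z0']].
rewrite (density_homogeneous X0 Y0 Z0 hom) (@density_homogeneous _ _ _ _ _ b) //.
  by rewrite subrr normr0 ltW.
by move=> x y z /sX ? /sY ? /sZ ?; apply: hom.
Qed.

Lemma card_preim_partition (V T : finType) (f : V -> T) :
  (#|preim_partition f [set: V]| <= #|T|)%N.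
Proof.
rewrite -cardsT.
apply: leq_trans (leq_imset_card (fun c => [set v | c == f v]) _).
apply/subset_leq_card/fintype.subsetP => A /imsetP[x _ ->].
apply/imsetP; exists (f x); rewrite ?inE //.
by apply/setP => y; rewrite !inE.
Qed.

(** A triple outside [bad] lies in a homogeneous, hence regular, triple of colour classes, so [bad]
    covers everything irregular. *)
Lemma coloring_reg_partition (V T : finType) (E : {set {set V}}) (eps : R)
    (col : V -> T) (bad : {set V * V * V}) :
  0 < eps ->
  (forall x y z x' y' z', (x, y, z) \notin bad ->
     col x' = col x -> col y' = col y -> col z' = col z ->
     edge3 E x' y' z' = edge3 E x y z) ->
  #|bad|%:R <= eps * (#|V| ^ 3)%N%:R ->
  reg_partition E eps (preim_partition col [set: V]).
Proof.
move=> e0 hom hbad.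
have pP := preim_partitionP col [set: V].
split=> //; set P := preim_partition _ _ in pP *.
have inP x : [set y | col x == col y] \in P.
  by apply/imsetP; exists x; rewrite ?inE //; apply/setP => y; rewrite !inE.
set G := (X in #|pred_of_set X|).
have : (#|V| ^ 3 <= #|bad| + #|G|)%N.
  rewrite -[(#|V| ^ 3)%N]/(#|V| * (#|V| * #|V|))%N mulnA -!card_prod -cardsT.
  apply: leq_trans (leq_card_setU _ _).
  apply/subset_leq_card/fintype.subsetP => -[[x y] z] _; rewrite inE.
  case: (boolP (_ \in bad)) => //= nbad; rewrite inE.
  apply/existsP; exists [set v | col x == col v]; rewrite inP /=.
  apply/existsP; exists [set v | col y == col v]; rewrite inP /=.
  apply/existsP; exists [set v | col z == col v]; rewrite inP /=.
  rewrite !inE !eqxx !andbT.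
  apply: (@homogeneous_reg_triple _ _ _ _ _ _ (edge3 E x y z)) => //.
  - by apply/card_gt0P; exists x; rewrite inE.
  - by apply/card_gt0P; exists y; rewrite inE.
  - by apply/card_gt0P; exists z; rewrite inE.
  - by move=> x' y' z'; rewrite !inE => /eqP ? /eqP ? /eqP ?; apply: hom.
rewrite -(@ler_nat R) natrD; lra.
Qed.

(** * Upper bound *)

(** A point is coloured by its kind, its bucket and whether it is the last index there; a set vertex
    by the buckets whose last index it contains. *)
Definition colour (K : nat) := (bool * 'I_K.+1 * bool + {set 'I_K.+1})%type.

Lemma card_colour K : (#|{: colour K}| <= 2 ^ (K + 4))%N.
Proof.
rewrite /colour card_sum !card_prod card_bool card_ord.
rewrite -cardsT -powersetT card_powerset cardsT card_ord.
rewrite addn4 !expnS; have := ltn_expl K (ltnSn 1); lia.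
Qed.
Section Upper.
Variables (V : finType) (f : V -> label) (K : nat).
Hypothesis V0 : (0 < #|V|)%N.

Definition pt (l : label) : option nat :=
  match l with LX i => Some i | LY i => Some i | LZ _ => None end.

Definition cumul (i : nat) : nat :=
  #|[set v | if pt (f v) is Some j then (j < i)%N else false]|.

Definition bucket (i : nat) : nat := (cumul i * K %/ #|V|)%N.

(* [big i] says that [i] is the last label of its bucket; the remaining labels
   of a bucket have total weight less than [#|V| / K]. *)
Definition big (i : nat) : bool := (bucket i < bucket i.+1)%N.

Lemma cumul_mono i j : (i <= j)%N -> (cumul i <= cumul j)%N.
Proof.
move=> ij; apply/subset_leq_card/fintype.subsetP => v; rewrite !inE.
by case: (pt (f v)) => // a /leq_trans; apply.
Qed.

Lemma bucket_mono i j : (i <= j)%N -> (bucket i <= bucket j)%N.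
Proof. by move=> ij; rewrite leq_div2r // leq_mul2r cumul_mono ?orbT. Qed.

(** The value [K] can occur, when [cumul i] reaches [#|V|]; hence [K.+1] buckets. *)
Lemma bucket_bound i : (bucket i < K.+1)%N.
Proof.
rewrite ltn_divLR //.
have : (cumul i <= #|V|)%N by apply: max_card.
by move: V0; nia.
Qed.

Lemma eq_bucket i j :
  (inord (bucket i) == inord (bucket j) :> 'I_K.+1) = (bucket i == bucket j).
Proof. by rewrite -val_eqE /= !inordK ?bucket_bound. Qed.

(** Past a big index the bucket number has strictly grown, so a bucket contains at most one big
    index. *)
Lemma big_inj i j : big i -> big j -> bucket i = bucket j -> i = j.
Proof.
move=> bi bj ij; apply/eqP; rewrite eqn_leq (leqNgt i) (leqNgt j); apply/andP; split.
  by apply/negP => /bucket_mono h; move: bj; rewrite /big ltnNge -ij h.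
by apply/negP => /bucket_mono h; move: bi; rewrite /big ltnNge ij h.
Qed.

Definition nonbig_in (g : nat) : {set V} :=
  [set v | if pt (f v) is Some i then ~~ big i && (bucket i == g) else false].

(** Let [v1] and [v2] have the least and greatest index in the set. The index of [v2] is not big, so
    its successor is still in bucket [g], and [cumul] grows by less than [#|V| / K] between the two
    ends. *)
Lemma card_nonbig_in g : (#|nonbig_in g| * K <= #|V|)%N.
Proof.
have [->|[v0 v0g]] := set_0Vmem (nonbig_in g); first by rewrite cards0.
(* The default 0 is never read: [lab] is only used on [nonbig_in g], whose members are points. *)
pose lab v := odflt 0%N (pt (f v)).
have labP v : v \in nonbig_in g ->
    [/\ pt (f v) = Some (lab v), bucket (lab v) = g & bucket (lab v).+1 = g].
  rewrite inE /lab; case: (pt (f v)) => //= i /andP[nb /eqP ig]; split=> //.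
  by apply/eqP; rewrite eqn_leq -{2}ig bucket_mono // andbT -ig leqNgt.
case: (arg_minnP lab v0g) => v1 /labP[_ v1g _] v1min.
case: (arg_maxnP lab v0g) => v2 /labP[_ _ v2g] v2max.
have : (cumul (lab v1) + #|nonbig_in g| <= cumul (lab v2).+1)%N.
  rewrite -cardsUI [X in (_ + X)%N](_ : _ = 0%N) ?addn0; last first.
    apply/eqP; rewrite cards_eq0; apply/eqP/setP => v.
    rewrite finset.in_setI finset.in_set0.
    apply/negP => /andP[lv vg]; have [ev _ _] := labP v vg.
    by move: lv; rewrite inE ev ltnNge v1min.
  apply/subset_leq_card/fintype.subsetP => v.
  rewrite finset.in_setU => /orP[|vg]; rewrite !inE.
    case: (pt (f v)) => // a /leq_trans; apply; apply: leqW.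
    by apply: leq_trans (v1min _ v0g) _; apply: v2max.
  by have [-> _ _] := labP v vg; rewrite ltnS; apply: v2max.
have : (cumul (lab v2).+1 * K < g.+1 * #|V|)%N.
  by rewrite -ltn_divLR // -/(bucket _) v2g.
have : (g * #|V| <= cumul (lab v1) * K)%N.
  by rewrite -{1}v1g /bucket leq_trunc_div.
rewrite mulSn; set n := #|V|; set a := cumul _; set b := cumul _.
set c := #|_| => h1 h2 h3.
have : ((a + c) * K <= b * K)%N by rewrite leq_mul2r h3 orbT.
rewrite mulnDl; lia.
Qed.

(* These colours decide adjacency, except through two non-big points of the same
   bucket. *)
Definition col (v : V) : colour K :=
  match f v with
  | LX i => inl (true, inord (bucket i), big i)
  | LY i => inl (false, inord (bucket i), big i)
  | LZ s => inr [set g | [exists u, if pt (f u) is Some i then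
                   [&& big i, inord (bucket i) == g & s i] else false]]
  end.

Definition crel (a b c : colour K) : bool :=
  match a, b, c with
  | inl (true, g, x), inl (false, h, y), inr s => [&& g == h, x, y & g \in s]
  | _, _, _ => false
  end.

Definition bad_pair (a b : colour K) : bool :=
  match a, b with
  | inl (_, g, x), inl (_, h, y) => [&& g == h, ~~ x & ~~ y]
  | _, _ => false
  end.

Lemma bad_pairC a b : bad_pair a b = bad_pair b a.
Proof.
case: a b => [[[? ?] ?]|?] [[[? ?] ?]|?] //=.
by rewrite eq_sym; congr (_ && _); rewrite andbC.
Qed.

(** Within one bucket, two big indices coincide, while a big and a non-big one differ. A bucket
    number in the colour of [z] thus stands for a single big index, and [x] itself witnesses that
    this index occurs. *)
Lemma orel_col x y z : ~~ bad_pair (col x) (col y) ->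
  orel (f x) (f y) (f z) = crel (col x) (col y) (col z).
Proof.
rewrite /col; case fx: (f x) => [i|i|s]; case: (f y) => [j|j|t] //=;
  case: (f z) => [k|k|u] //=; rewrite eq_bucket.
case: (eqVneq (bucket i) (bucket j)) => [ij /=|]; last first.
  by case: (eqVneq i j) => // ->; rewrite eqxx.
case bi: (big i); case bj: (big j) => //= _; last 2 first.
- by case: eqP => // ij'; rewrite ij' bj in bi.
- by case: eqP => // ij'; rewrite ij' bj in bi.
rewrite (big_inj bi bj ij) eqxx inE /=.
apply/idP/existsP => [uj|[v]].
  by exists x; rewrite fx /= (big_inj bi bj ij) bj eqxx.
case: (pt (f v)) => // k /and3P[bk]; rewrite eq_bucket => /eqP kj.
by rewrite (big_inj bk bj kj).
Qed.

Definition bad : {set V * V * V} :=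
  [set t | [|| bad_pair (col t.1.1) (col t.1.2), bad_pair (col t.1.1) (col t.2)
             | bad_pair (col t.1.2) (col t.2)]].

Lemma lrel_col x y z : (x, y, z) \notin bad ->
  lrel (f x) (f y) (f z) =
  [|| crel (col x) (col y) (col z), crel (col x) (col z) (col y),
      crel (col y) (col x) (col z), crel (col y) (col z) (col x),
      crel (col z) (col x) (col y) | crel (col z) (col y) (col x)].
Proof.
rewrite inE /= !negb_or => /and3P[xy xz yz].
by rewrite /lrel !orel_col //; rewrite bad_pairC.
Qed.

(** For fixed [u], all bad partners are non-big points in the bucket of [u]. *)
Lemma card_bad_pair :
  (#|[set p : V * V | bad_pair (col p.1) (col p.2)]| * K <= #|V| * #|V|)%N.
Proof.
rewrite -sum1_card (eq_bigl (fun p => true && bad_pair (col p.1) (col p.2)));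
  last by move=> p; rewrite inE.
rewrite -(pair_big_dep xpredT (fun u v => bad_pair (col u) (col v))
  (fun _ _ => 1%N)) /= big_distrl /= -sum_nat_const.
apply: leq_sum => u _; rewrite sum1_card.
case cu: (col u) => [[[a g] b]|s]; last by rewrite eq_card0.
apply: leq_trans (card_nonbig_in g); rewrite leq_mul2r; apply/orP; right.
apply/subset_leq_card/fintype.subsetP => v; rewrite unfold_in /= inE /col.
by case: (f v) => //= i /and3P[/eqP-> _ ->]; rewrite inordK ?bucket_bound ?eqxx.
Qed.

Lemma card_bad : (#|bad| * K <= 3 * #|V| ^ 3)%N.
Proof.
set Q := [set p : V * V | bad_pair (col p.1) (col p.2)].
pose A := finset.setX Q [set: V].
(* [g1] and [g2] move the bad pair from coordinates 1, 2 to coordinates 1, 3 and 2, 3. *)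
pose g1 (t : V * V * V) := (t.1.1, t.2, t.1.2).
pose g2 (t : V * V * V) := (t.2, t.1.1, t.1.2).
have : (#|bad| <= #|A| + (#|A| + #|A|))%N.
  apply: leq_trans
    (leq_add (leqnn _) (leq_add (leq_imset_card g1 A) (leq_imset_card g2 A))).
  apply: leq_trans (leq_add (leqnn _) (leq_card_setU _ _)).
  apply: leq_trans (leq_card_setU _ _).
  apply/subset_leq_card/fintype.subsetP => -[[x y] z]; rewrite !inE /= andbT.
  case/or3P => [->//|xz|yz]; apply/orP; right; apply/orP; [left|right].
    by apply/imsetP; exists (x, z, y); rewrite ?inE /= ?xz.
  by apply/imsetP; exists (y, z, x); rewrite ?inE /= ?yz.
rewrite cardsX cardsT => h; have := card_bad_pair; rewrite -/Q.
set q := #|Q| in h *; set n := #|V| in h *; rewrite expnS expnS expn1 => h2.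
have := leq_mul h (leqnn K); have := leq_mul h2 (leqnn n); lia.
Qed.

End Upper.

(** At most [3 * #|V| ^ 3 / K] triples are bad, and [3 <= eps * K] makes this at most an
    [eps]-fraction. *)
Lemma labelled_reg_bound (K : nat) (eps : R) :
  0 < eps -> 3 <= eps * K%:R -> reg_bound labelled eps (2 ^ (K + 4))%N.
Proof.
move=> e0 eK; exists 1%N => V E [_ [f Ef]] V0.
exists (preim_partition (col f K) [set: V]); split; last first.
  exact: leq_trans (card_preim_partition _) (card_colour _).
apply: (coloring_reg_partition (bad := bad f K)) => //.
  move=> x y z x' y' z' nb cx cy cz; rewrite !Ef.
  rewrite !(lrel_col (K := K)) // ?cx ?cy ?cz // inE /= cx cy cz.
  by move: nb; rewrite inE.
have := card_bad f K V0; rewrite -(ler_nat R) natrM natrM.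
set b := _%:R; set n := (#|V| ^ 3)%N%:R => h.
have n0 : 0 <= n by rewrite ler0n.
have K0 : 0 < K%:R :> R by rewrite -(pmulr_rgt0 _ e0); lra.
rewrite -(ler_pM2r K0); apply: le_trans h _.
by rewrite mulrAC ler_wpM2r.
Qed.

(** * Distance from finite VC-dimension *)

(* The first coordinate selects the kind of label, and only one of the other two
   coordinates is then read: the idle one makes the three kinds equally large. *)
Definition blow_base (k : nat) := ('I_3 * 'I_k * {set 'I_k})%type.

Definition set_label (k : nat) (S : {set 'I_k}) : nat -> bool :=
  fun n => if insub n is Some i then i \in S else false.

Lemma set_labelE k (S : {set 'I_k}) (i : 'I_k) : set_label S i = (i \in S).
Proof. by rewrite /set_label valK. Qed.

Definition blow_label (k m : nat) (v : blow_base k * 'I_m) : label :=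
  let: ((t, i, s), _) := v in
  if t == 0 then LX i else if t == 1 then LY i else LZ (set_label s).

Definition blowup (k m : nat) := lgraph (@blow_label k m).

Lemma card_blow k m : #|{: blow_base k * 'I_m}| = (3 * (k * 2 ^ k * m))%N.
Proof.
rewrite !card_prod !card_ord -cardsT -powersetT card_powerset cardsT card_ord.
by rewrite !mulnA.
Qed.

(* Swapping the three coordinates [r x, r y, r z] of a function with an
   independent triple is an involution: the triple seen by a random function at
   three distinct places is uniform. *)
Lemma card_ffun_three (B T : finType) (x y z : B) (P : pred (T * T * T)) :
  x != y -> x != z -> y != z ->
  (#|[set r : {ffun B -> T} | P (r x, r y, r z)]| * #|T| ^ 3
     <= #|T| ^ #|B| * #|[set p | P p]|)%N.
Proof.
move=> xy xz yz.
pose sw (u : {ffun B -> T} * (T * T * T)) :=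
  ([ffun b => if b == x then u.2.1.1 else if b == y then u.2.1.2
              else if b == z then u.2.2 else u.1 b] : {ffun B -> T},
   (u.1 x, u.1 y, u.1 z)).
have swI : injective sw.
  apply: inv_inj => -[r [[p q] t]]; rewrite /sw /= !ffunE !eqxx.
  rewrite ![y == _]eq_sym ![z == _]eq_sym (negPf xy) (negPf xz) (negPf yz).
  congr (_, _); apply/ffunP => b; rewrite !ffunE.
  by case: eqP => [->//|_]; case: eqP => [->//|_]; case: eqP => [->//|].
have -> : (#|T| ^ 3 = #|[set: T * T * T]|)%N.
  by rewrite cardsT !card_prod !expnS muln1 mulnA.
have -> : (#|T| ^ #|B| = #|[set: {ffun B -> T}]|)%N by rewrite cardsT card_ffun.
rewrite -!cardsX -(card_imset _ swI).
apply/subset_leq_card/fintype.subsetP => w /imsetP[[r p]].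
by rewrite !inE /= andbT => h ->; rewrite /sw.
Qed.

Lemma labelled_far : far_from_finite_VC labelled.
Proof.
move=> H' _ [d Hd] Hclose.
pose k := d.+1; pose B := blow_base k.
pose Q := (#|{: 'I_k * {set 'I_k}}|)%N.
have Q0 : (0 < Q)%N by apply/card_gt0P; exists (ord0, finset.set0).
pose b := #|{: B}|.
have b0 : (0 < b)%N by apply/card_gt0P; exists (ord0, ord0, finset.set0).
(* With this [delta], at most [m ^ 3 / (2 * Q)] triples change, where [Q] counts the pairs [(i, S)]
   to be preserved. *)
pose delta : R := ((2 * Q * b ^ 3)%N%:R)^-1.
have den0 : (0 < 2 * Q * b ^ 3)%N by rewrite 2!muln_gt0 Q0 expn_gt0 b0.
have delta0 : 0 < delta by rewrite invr_gt0 ltr0n.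
have [N HN] := Hclose _ delta0.
pose m := N.+1.
have cV : (N <= #|{: B * 'I_m}|)%N.
  rewrite card_prod card_ord -/b; apply: leq_trans (leqnSn N) _.
  by rewrite leq_pmull.
have [E' [HE' dE]] := HN _ _ (lgraph_labelled (@blow_label k m)) cV.
pose E := blowup k m.
pose D := [set t : (B * 'I_m) * (B * 'I_m) * (B * 'I_m) |
  edge3 E t.1.1 t.1.2 t.2 != edge3 E' t.1.1 t.1.2 t.2].
have Dsmall : (2 * Q * #|D| <= m ^ 3)%N.
  move: dE; rewrite /delta_close -/E -/D /delta card_prod card_ord -/b -/m.
  rewrite mulrC ler_pdivlMr; last by rewrite ltr0n.
  rewrite -natrM ler_nat expnMn => h.
  by rewrite -(@leq_pmul2l (b ^ 3)) ?expn_gt0 ?b0 //; apply: leq_trans h; lia.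
(* These base vertices carry the labels of the full structure; the idle coordinates get arbitrary
   fixed values. *)
pose xa (i : 'I_k) : B := (0, i, finset.set0).
pose xb (i : 'I_k) : B := (1, i, finset.set0).
pose xc (S : {set 'I_k}) : B := (2%:R, ord0, S).
pose T := ('I_m : finType).
pose wrong (u : 'I_k * {set 'I_k}) (p : T * T * T) : bool :=
  ((xa u.1, p.1.1), (xb u.1, p.1.2), (xc u.2, p.2)) \in D.
pose W u := [set r : {ffun B -> T} |
   wrong u (r (xa u.1), r (xb u.1), r (xc u.2))].
(* A random transversal [r] is wrong at a given pair with probability at most [1 / (2 * Q)]; the
   three base vertices are distinct because their kinds are. *)
have cW u : (2 * Q * #|W u| <= m ^ b)%N.
  have le1 := @card_ffun_three B T (xa u.1) (xb u.1) (xc u.2) (wrong u)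
    isT isT isT.
  have le2 : (#|[set p | wrong u p]| <= #|D|)%N.
    pose g (p : T * T * T) := ((xa u.1, p.1.1), (xb u.1, p.1.2), (xc u.2, p.2)).
    have gI : injective g by move=> [[? ?] ?] [[? ?] ?] [-> -> ->].
    rewrite -(card_imset _ gI); apply/subset_leq_card/fintype.subsetP.
    by move=> t /imsetP[p]; rewrite inE => pw ->.
  rewrite -(@leq_pmul2r (m ^ 3)) ?expn_gt0 // -mulnA.
  rewrite card_ord -/b -/(W u) in le1.
  apply: leq_trans (leq_mul (leqnn (2 * Q)) le1) _.
  rewrite mulnCA leq_mul2l; apply/orP; right.
  by apply: leq_trans Dsmall; rewrite leq_mul2l le2 orbT.
(* By the union bound at most half of all transversals are wrong somewhere, so a good one exists. *)
pose U := \bigcup_u W u.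
have cU : (2 * Q * #|U| <= Q * m ^ b)%N.
  rewrite -sum_nat_const.
  apply: leq_trans (_ : (\sum_u 2 * Q * #|W u| <= _)%N); last exact: leq_sum.
  rewrite -big_distrr leq_mul2l /=; apply/orP; right.
  apply: (big_rec2 (fun A n => (#|pred_of_set A| <= n)%N)) => [|u A n _ le].
    by rewrite cards0.
  by apply: leq_trans (leq_card_setU _ _) _; rewrite leq_add2l.
have {cU}cU : (#|U| < #|[set: {ffun B -> T}]|)%N.
  have mb : (0 < m ^ b)%N by rewrite expn_gt0.
  rewrite cardsT card_ffun card_ord -/b -(ltn_pmul2l Q0).
  have : (0 < Q * m ^ b)%N by rewrite muln_gt0 Q0.
  move: cU; rewrite -mulnA; lia.
have [U0|[r]] := set_0Vmem (~: U)%SET.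
  by move: cU; rewrite -(finset.setCK U) U0 finset.setC0 ltnn.
rewrite finset.in_setC => rU.
have rgood u : ~~ wrong u (r (xa u.1), r (xb u.1), r (xc u.2)).
  by apply: contra rU => wu; apply/bigcupP; exists u; rewrite // inE.
suff /(Hd _ _ _ HE') : shatters3 E' k by rewrite /k ltnn.
exists (fun i => (xa i, r (xa i))), (fun i => (xb i, r (xb i))),
  (fun S => (xc S, r (xc S))) => i S.
have := rgood (i, S); rewrite /wrong inE /= negbK => /eqP.
rewrite /edge3 => <-; rewrite -/(edge3 _ _ _ _) lgraph_edge3.
by rewrite /lrel /= eqxx set_labelE !orbF.
Qed.

(** * Lower bound *)

(** Used with [d = 0] to bound thin vertices, and with [d = k * m] to bound the number of parts from
    below. *)
Lemma partition_card_bound (V : finType) (P : {set {set V}}) (T : {set V})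
    (c d : R) :
  finset.partition P [set: V] ->
  (forall A, A \in P -> #|T :&: A|%:R <= c * #|A|%:R + d) ->
  #|T|%:R <= c * #|V|%:R + d * #|P|%:R.
Proof.
move=> pP h; have /and3P[/eqP cP tP _] := pP.
have -> : #|T| = (\sum_(A in P) #|T :&: A|)%N.
  rewrite -sum1_card (partition_big (finset.pblock P) (mem P)) /=; last first.
    by move=> x _; rewrite pblock_mem // cP inE.
  apply: eq_bigr => A AP; rewrite -sum1_card; apply: eq_bigl => x.
  rewrite !inE; congr (_ && _); apply/eqP/idP => [<-|xA].
    by rewrite mem_pblock cP inE.
  exact: def_pblock.
have -> : #|V| = (\sum_(A in P) #|A|)%N by rewrite -cardsT (card_partition pP).
rewrite !natr_sum mulr_sumr [d * _]mulrC mulr_natl -sumr_const -big_split /=.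
exact: ler_sum.
Qed.

(** A part containing a counted vertex meets [D] in less than an [eps]-fraction; summing over the
    parts gives the bound. *)
Lemma card_thin (V : finType) (P : {set {set V}}) (D : {set V}) (eps : R) :
  finset.partition P [set: V] -> 0 <= eps ->
  #|[set x in D | #|finset.pblock P x :&: D|%:R < eps * #|finset.pblock P x|%:R]|%:R
    <= eps * #|V|%:R.
Proof.
move=> pP e0; rewrite -[X in _ <= X]addr0 -[X in _ + X](mul0r #|P|%:R).
apply: partition_card_bound => // A AP; rewrite addr0.
have /and3P[_ tP _] := pP.
set S := [set x in D | _].
have [->|[x]] := set_0Vmem (S :&: A); first by rewrite cards0 mulr_ge0.
rewrite !inE => /andP[/andP[xD]]; move=> + xA.
rewrite (def_pblock tP AP xA) => /ltW; apply: le_trans.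
rewrite ler_nat; apply/subset_leq_card/fintype.subsetP => y.
by rewrite !inE => /andP[/andP[-> _] ->].
Qed.

(** Regularity would put the density of [(A, B, C)] within [eps < 1/2] of both 1 and 0. *)
Lemma reg_triple_dichotomy (V : finType) (E : {set {set V}}) (eps : R)
    (A B C X Y Z1 Z0 : {set V}) :
  0 < eps -> eps < 2^-1 -> reg_triple E eps A B C ->
  (0 < #|A|)%N -> (0 < #|B|)%N -> (0 < #|C|)%N ->
  eps * #|A|%:R <= #|A :&: X|%:R -> eps * #|B|%:R <= #|B :&: Y|%:R ->
  eps * #|C|%:R <= #|C :&: Z1|%:R -> eps * #|C|%:R <= #|C :&: Z0|%:R ->
  (forall x y z, x \in X -> y \in Y -> z \in Z1 -> edge3 E x y z) ->
  (forall x y z, x \in X -> y \in Y -> z \in Z0 -> ~~ edge3 E x y z) ->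
  False.
Proof.
move=> e0 e2 rABC A0 B0 C0 hA hB h1 h0 E1 E0.
have pos (S T : {set V}) :
    (0 < #|S|)%N -> eps * #|S|%:R <= #|S :&: T|%:R -> (0 < #|S :&: T|)%N.
  move=> S0 ST; rewrite -(@ltr_nat R); apply: lt_le_trans ST.
  by rewrite mulr_gt0 // ltr0n.
have sub (S T : {set V}) : S :&: T \subset S by apply: finset.subsetIl.
have dens (Z : {set V}) (b : bool) : eps * #|C|%:R <= #|C :&: Z|%:R ->
    (forall x y z, x \in X -> y \in Y -> z \in Z -> edge3 E x y z = b) ->
    `|density E A B C - b%:R| <= eps.
  move=> hZ hom.
  have := rABC; move/forallP => /(_ (A :&: X)) /forallP/(_ (B :&: Y)).
  move/forallP => /(_ (C :&: Z)) /implyP.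
  rewrite !sub hA hB hZ => /(_ isT).
  rewrite (@density_homogeneous _ _ (A :&: X) (B :&: Y) (C :&: Z) b) //.
  - exact: pos hA.
  - exact: pos hB.
  - exact: pos hZ.
  - move=> x y z; rewrite !inE => /andP[_ ?] /andP[_ ?] /andP[_ ?]; exact: hom.
have := dens Z1 true h1 (fun x y z hx hy hz => E1 x y z hx hy hz).
have := dens Z0 false h0 (fun x y z hx hy hz => negbTE (E0 x y z hx hy hz)).
rewrite /= !ler_norml; lra.
Qed.

(** * Regular partitions of a blow-up have many parts *)

Section Lower.
Variables (k m : nat) (eps : R) (P : {set {set blow_base k * 'I_m}}).
Hypotheses (k0 : (0 < k)%N) (m0 : (0 < m)%N) (e0 : 0 < eps).
Hypothesis ek : 432%:R * eps * k%:R ^+ 3 <= 1.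
Hypothesis regP : reg_partition (blowup k m) eps P.

Let V : finType := (blow_base k * 'I_m)%type.
Let E := blowup k m.
Let pb (v : V) := finset.pblock P v.

Let kind (v : V) : 'I_3 := v.1.1.1.
Let idx (v : V) : 'I_k := v.1.1.2.
Let elts (v : V) : {set 'I_k} := v.1.2.

Let X (i : 'I_k) : {set V} := [set v | (kind v == 0) && (idx v == i)].
Let Y (i : 'I_k) : {set V} := [set v | (kind v == 1) && (idx v == i)].
Let Z : {set V} := [set v | kind v == 2%:R].
Let Zin (i : 'I_k) : {set V} := [set v in Z | i \in elts v].
Let Zout (i : 'I_k) : {set V} := [set v in Z | i \notin elts v].

(** If [v] is not thin for [D], its part meets [D] in a subset large enough to be tested by
    regularity. *)
Let thin (D : {set V}) (v : V) : bool := #|pb v :&: D|%:R < eps * #|pb v|%:R.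
Let fat (D : {set V}) : {set V} := [set v in D | ~~ thin D v].

Let split_by (i : 'I_k) : {set V} :=
  [set v in Z | ~~ thin (Zin i) v && ~~ thin (Zout i) v].

(** This is the common size of the three kinds; each [X i] and [Y i] has size [w / k]. *)
Let w := (k * 2 ^ k * m)%N.

Let pP : finset.partition P [set: V]. Proof. by case: regP. Qed.

Let cardV : #|V| = (3 * w)%N. Proof. exact: card_blow. Qed.

Let w0 : 0 < w%:R :> R.
Proof. by rewrite ltr0n !muln_gt0 k0 m0 expn_gt0. Qed.

Let ek1 : eps * k%:R <= 432%:R^-1.
Proof.
have k1 : 1 <= k%:R :> R by rewrite ler1n.
have : eps * k%:R <= eps * k%:R ^+ 3.
  by rewrite ler_pM2l // -[X in X <= _]expr1 ler_weXn2l.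
by move: ek; rewrite -mulrA; lra.
Qed.

Let edge_in i x y z : x \in X i -> y \in Y i -> z \in Zin i -> edge3 E x y z.
Proof.
rewrite !inE /E lgraph_edge3 /kind /idx /elts.
case: x => [[[a i1] S1] p1]; case: y => [[[b i2] S2] p2].
case: z => [[[c i3] S3] p3] /= /andP[/eqP-> /eqP->] /andP[/eqP-> /eqP->].
by case/andP => /eqP-> iS; rewrite /lrel /= eqxx set_labelE iS.
Qed.

Let edge_out i x y z :
  x \in X i -> y \in Y i -> z \in Zout i -> ~~ edge3 E x y z.
Proof.
rewrite !inE /E lgraph_edge3 /kind /idx /elts.
case: x => [[[a i1] S1] p1]; case: y => [[[b i2] S2] p2].
case: z => [[[c i3] S3] p3] /= /andP[/eqP-> /eqP->] /andP[/eqP-> /eqP->].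
by case/andP => /eqP-> iS; rewrite /lrel /= eqxx set_labelE (negPf iS).
Qed.

Let card_slot (t : 'I_3) (i : 'I_k) :
  (#|[set v : V | (kind v == t) && (idx v == i)]| = 2 ^ k * m)%N.
Proof.
have -> : [set v : V | (kind v == t) && (idx v == i)] =
    finset.setX (finset.setX [set (t, i)] [set: {set 'I_k}]) [set: 'I_m].
  by apply/setP => -[[[a b] S] p]; rewrite !inE /= !andbT.
by rewrite !cardsX cards1 !cardsT -cardsT -powersetT card_powerset cardsT !card_ord mul1n.
Qed.

Let card_Z : #|Z| = w.
Proof.
have -> : Z = finset.setX (finset.setX (finset.setX [set 2%:R] [set: 'I_k])
    [set: {set 'I_k}]) [set: 'I_m].
  by apply/setP => -[[[a b] S] p]; rewrite !inE /= !andbT.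
rewrite !cardsX cards1 -powersetT card_powerset !cardsT !card_ord mul1n.
by [].
Qed.

(** At most [3 * eps * w], that is [3 * eps * k * #|D|], vertices of [D] are thin, which is well
    below half of [D]. *)
Let card_fat (D : {set V}) : (#|D| = 2 ^ k * m)%N ->
  w%:R / (2 * k%:R) <= #|fat D|%:R :> R.
Proof.
move=> cD; have := card_thin D pP (ltW e0).
rewrite -/pb cardV natrM => h.
have : (#|D| <= #|fat D| + #|[set x in D | thin D x]|)%N.
  rewrite -cardsUI; apply: leq_trans (leq_addr _ _).
  apply/subset_leq_card/fintype.subsetP => x xD; rewrite !inE xD /=.
  by case: (thin D x).
rewrite -(ler_nat R) natrD cD => h2.
have kR : 0 < k%:R :> R by rewrite ltr0n.
have wE : w%:R = k%:R * (2 ^ k * m)%N%:R :> R by rewrite -natrM mulnA.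
rewrite ler_pdivrMr; last by rewrite mulr_gt0.
have := ek1; have := w0; rewrite /thin in h2.
rewrite wE in h *; set u := (2 ^ k * m)%N%:R in h h2 *.
move=> u0 ek1b; have {}u0 : 0 < u by rewrite -(pmulr_rgt0 _ kR).
set tn := #|[set x in D | _]|%:R in h h2.
have : 3 * (eps * k%:R) * u <= 432%:R^-1 * 3 * u by rewrite ler_pM2r //; lra.
rewrite (_ : eps * _ = 3 * (eps * k%:R) * u) in h; last by ring.
move=> h3; rewrite [leRHS](_ : _ = k%:R * (2 * #|fat D|%:R)); last by ring.
rewrite ler_pM2l //; lra.
Qed.


Let split_irregular i x y z : x \in fat (X i) -> y \in fat (Y i) ->
  z \in split_by i ->
  ~~ [exists A in P, exists B in P, exists C in P,
       [&& reg_triple E eps A B C, x \in A, y \in B & z \in C]].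
Proof.
move=> /finset.setIdP[xX nx] /finset.setIdP[yY ny] /finset.setIdP[zZ /andP[nz1 nz0]].
apply/negP => /existsP[A /andP[AP /existsP[B /andP[BP /existsP[C]]]]].
case/andP => CP /and4P[rABC xA yB zC].
have /and3P[_ tP _] := pP.
move: nx ny nz1 nz0; rewrite /thin /pb -!leNgt.
rewrite (def_pblock tP AP xA) (def_pblock tP BP yB) (def_pblock tP CP zC).
move=> hA hB h1 h0.
apply: (reg_triple_dichotomy e0 _ rABC _ _ _ hA hB h1 h0).
- have := ek1; have : 1 <= k%:R :> R by rewrite ler1n.
  by have := e0; nra.
- by apply/card_gt0P; exists x.
- by apply/card_gt0P; exists y.
- by apply/card_gt0P; exists z.
- exact: edge_in.
- exact: edge_out.
Qed.

(** All triples in [fat (X i) * fat (Y i) * split_by i] are irregular, so their number is at most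
    [eps * (3 * w) ^ 3]. *)
Let card_split i : #|split_by i|%:R <= w%:R / (4 * k%:R) :> R.
Proof.
have [_] := regP; set G := (X in #|pred_of_set X|) => hG.
have : (#|G| + #|finset.setX (finset.setX (fat (X i)) (fat (Y i))) (split_by i)|
    <= #|V| ^ 3)%N.
  rewrite -cardsUI [X in (_ + X)%N](_ : _ = 0%N) ?addn0.
    by rewrite !expnS muln1 mulnA -!card_prod max_card.
  apply/eqP; rewrite cards_eq0; apply/eqP/setP => -[[x y] z].
  rewrite finset.in_setI finset.in_set0; apply/negP => /andP[].
  rewrite inE /= => hx /finset.setXP[/finset.setXP[/= xf yf] zs].
  by move: hx; apply/negP; exact: (split_irregular xf yf zs).
rewrite !cardsX => hh; rewrite -(ler_nat R) natrD 2!natrM in hh.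
have fx := card_fat (card_slot 0 i); have fy := card_fat (card_slot 1 i).
rewrite -/(X i) in fx; rewrite -/(Y i) in fy.
have hs : #|fat (X i)|%:R * #|fat (Y i)|%:R * #|split_by i|%:R
    <= eps * 27%:R * w%:R ^+ 3 :> R.
  have -> : eps * 27%:R * w%:R ^+ 3 = eps * (#|V| ^ 3)%N%:R.
    by rewrite cardV natrX natrM; ring.
  move: hG hh; rewrite -/G; set g := #|G|%:R; set n3 := (_ ^ 3)%N%:R.
  by set t := _ * _ * _; lra.
have kR : 0 < k%:R :> R by rewrite ltr0n.
set a := w%:R / (2 * k%:R) in fx fy.
have a0 : 0 < a by rewrite divr_gt0 // mulr_gt0.
have hs2 : a * a * #|split_by i|%:R <= eps * 27%:R * w%:R ^+ 3.
  apply: le_trans hs; rewrite ler_wpM2r //; apply: ler_pM => //; exact: ltW.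
rewrite -(ler_pM2l (mulr_gt0 a0 a0)); apply: le_trans hs2 _.
(* The constant 432 is [27 * 16]: 27 from [#|V| = 3 * w], 16 from the denominators [2 * k], [2 * k]
   and [4 * k]. *)
have -> : a * a * (w%:R / (4 * k%:R)) = w%:R ^+ 3 / (16 * k%:R ^+ 3).
  by rewrite /a; field; rewrite gt_eqF.
rewrite ler_pdivlMr; last by rewrite mulr_gt0 // exprn_gt0.
rewrite [leLHS](_ : _ = (432%:R * eps * k%:R ^+ 3) * w%:R ^+ 3); last by ring.
by rewrite -[leRHS]mul1r ler_wpM2r // exprn_ge0 // ltW.
Qed.

Let unsplit : {set V} := Z :\: \bigcup_i split_by i.

(** Each of the [k] indices removes at most [w / (4 * k)] vertices. *)
Let card_unsplit : 3 / 4 * w%:R <= #|unsplit|%:R :> R.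
Proof.
have : (#|Z| <= #|unsplit| + \sum_i #|split_by i|)%N.
  apply: (@leq_trans (#|unsplit| + #|\bigcup_i split_by i|)%N); last first.
    rewrite leq_add2l.
    apply: (big_rec2 (fun A n => (#|pred_of_set A| <= n)%N)) => [|u A n _ le].
      by rewrite cards0.
    by apply: leq_trans (leq_card_setU _ _) _; rewrite leq_add2l.
  apply: leq_trans (leq_card_setU _ _).
  apply/subset_leq_card/fintype.subsetP => z zZ.
  rewrite finset.in_setU finset.in_setD zZ andbT.
  by case: (z \in \bigcup_i _).
rewrite card_Z -(ler_nat R) natrD natr_sum => h.
have : \sum_i #|split_by i|%:R <= \sum_(i < k) (w%:R / (4 * k%:R)) :> R.
  by apply: ler_sum => i _; apply: card_split.
rewrite sumr_const card_ord -[leRHS]mulr_natl.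
have -> : k%:R * (w%:R / (4 * k%:R)) = w%:R / 4 :> R.
  by field; rewrite pnatr_eq0 -lt0n.
lra.
Qed.

(* In an unsplit part every [i] is decided up to an [eps]-fraction, so up to an
   [eps * k]-fraction all elements carry the same set. *)
Let card_unsplit_part A : A \in P ->
  #|unsplit :&: A|%:R <= (eps * k%:R) * #|A|%:R + (k * m)%N%:R :> R.
Proof.
move=> AP; have /and3P[_ tP _] := pP.
have [->|[z0]] := set_0Vmem (unsplit :&: A).
  by rewrite cards0 addr_ge0 // !mulr_ge0 // ltW.
rewrite finset.in_setI finset.in_setD => /andP[/andP[nsplit z0Z] z0A].
have pz0 : pb z0 = A by apply: def_pblock.
(* [T] is the set prescribed by the part: as [z0] is unsplit, [Zout i] is thin for [i] in [T], and
   [Zin i] for the others. *)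
pose T := [set i | ~~ thin (Zin i) z0].
pose W i := A :&: [set z in Z | (i \in elts z) != (i \in T)].
have hW i : #|W i|%:R <= eps * #|A|%:R :> R.
  have : z0 \notin split_by i.
    by apply: contra nsplit => zi; apply/bigcupP; exists i.
  rewrite inE z0Z /= negb_and !negbK /thin pz0.
  have -> : W i = A :&: (if i \in T then Zout i else Zin i).
    rewrite /W; congr (_ :&: _); case: (i \in T); apply/setP => z; rewrite !inE;
      by case: (i \in elts z).
  rewrite [i \in T]inE /thin pz0.
  by case: ltP => [/ltW|_ /ltW].
pose F := [set v : V | (kind v == 2%:R) && (elts v == T)].
have cF : (#|F| = k * m)%N.
  have -> : F = finset.setX (finset.setX (finset.setX [set 2%:R] [set: 'I_k])
      [set T]) [set: 'I_m].
    by apply/setP => -[[[a b] S] p]; rewrite !inE /= !andbT.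
  by rewrite !cardsX !cards1 !cardsT !card_ord mul1n muln1.
have : (#|unsplit :&: A| <= \sum_i #|W i| + #|F|)%N.
  apply: (@leq_trans (#|\bigcup_i W i| + #|F|)%N); last first.
    rewrite leq_add2r.
    apply: (big_rec2 (fun A n => (#|pred_of_set A| <= n)%N)) => [|u B n _ le].
      by rewrite cards0.
    by apply: leq_trans (leq_card_setU _ _) _; rewrite leq_add2l.
  apply: leq_trans (leq_card_setU _ _).
  apply/subset_leq_card/fintype.subsetP => z.
  rewrite finset.in_setI finset.in_setD finset.in_setU => /andP[/andP[_ zZ] zA].
  have [zT|/eqP/setP zT] := eqVneq (elts z) T.
    by apply/orP; right; move: zZ; rewrite !inE zT eqxx andbT.
  have [i zi] : exists i, (i \in elts z) != (i \in T).
    apply/existsP; apply: contraT; rewrite negb_exists => /forallP h.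
    by case: zT => i; apply/eqP; rewrite -[_ == _]negbK; apply: h.
  apply/orP; left; apply/bigcupP; exists i => //.
  by rewrite finset.in_setI zA inE zZ.
rewrite cF -(ler_nat R) natrD natr_sum => /le_trans; apply.
rewrite lerD2r; apply: le_trans (_ : \sum_(i < k) eps * #|A|%:R <= _).
  by apply: ler_sum.
by rewrite sumr_const card_ord -[leLHS]mulr_natl mulrA [k%:R * _]mulrC.
Qed.

(** The unsplit vertices give [3/4 * w <= w / 144 + k * m * #|P|], where [w = 2 ^ k * (k * m)]. *)
Lemma blowup_parts : (2 ^ k <= 2 * #|P|)%N.
Proof.
have := partition_card_bound pP card_unsplit_part; rewrite cardV natrM => h.
have h1 := card_unsplit; have h2 := ek1; have h3 := w0.
have wE : w%:R = (2 ^ k)%N%:R * (k * m)%N%:R :> R.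
  by rewrite -natrM /w; congr _%:R; lia.
have u0 : 0 < (k * m)%N%:R :> R by rewrite ltr0n muln_gt0 k0.
rewrite -(ler_nat R) natrM -(ler_pM2r u0).
have : eps * k%:R * (3 * w%:R) <= 432%:R^-1 * (3 * w%:R).
  by rewrite ler_wpM2r // mulr_ge0 // ltW.
rewrite wE in h h1 h3 *; set u := (k * m)%N%:R in h h1 h3 *.
set p := #|P|%:R in h *; set q := (2 ^ k)%N%:R in h h1 h3 *.
have -> : 2 * p * u = 2 * (u * p) by ring.
lra.
Qed.

End Lower.

(** * From the combinatorial bounds to powers of [eps] *)

Lemma reg_bound_parts (k : nat) (eps : R) (M : nat) :
  (0 < k)%N -> 0 < eps -> 432%:R * eps * k%:R ^+ 3 <= 1 ->
  reg_bound labelled eps M -> (2 ^ k <= 2 * M)%N.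
Proof.
move=> k0 e0 ek [N HN].
have big : (N <= #|{: blow_base k * 'I_(N.+1)}|)%N.
  rewrite card_blow mulnA; apply: leq_trans (leqnSn N) _.
  by rewrite leq_pmull // !muln_gt0 k0 expn_gt0.
have [P [regP cP]] := HN _ _ (lgraph_labelled (@blow_label k N.+1)) big.
by apply: leq_trans (blowup_parts k0 _ e0 ek regP) _; rewrite // leq_mul2l cP.
Qed.

Lemma exists_MH (H : prop3) (eps : R) (M : nat) :
  reg_bound H eps M -> exists M0, is_MH H eps M0.
Proof.
move=> hM.
have ex : exists n, `[< reg_bound H eps n >] by exists M; apply/asboolP.
exists (ex_minn ex); case: ex_minnP => n /asboolP hn minn; split=> // M' hM'.
by apply: minn; apply/asboolP.
Qed.

Lemma powR_quarterV (eps : R) : 0 < eps -> (eps `^ (- (1 / 4))) ^+ 4 = eps^-1.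
Proof.
move=> e0; rewrite -powR_mulrn ?powR_ge0 // -powRrM.
have -> : - (1 / 4) * 4%:R = -1 :> R by lra.
by rewrite powR_inv1 // ltW.
Qed.

Lemma labelled_lower (eps : R) (M : nat) :
  0 < eps -> eps < (10 ^+ 16)^-1 -> reg_bound labelled eps M ->
  2 `^ (eps `^ (- (1 / 4))) <= M%:R.
Proof.
move=> e0 esm hM; have := powR_quarterV e0.
set t := eps `^ _ => t4.
have t0 : 0 <= t by apply: powR_ge0.
(* The threshold on [eps] makes [t] exceed [3456 = 432 * 2 ^ 3], which absorbs the constants in
   [ek], as [k <= 2 * t]. *)
have tbig : 10 ^+ 4 < t.
  rewrite -(@ltr_pXn2r _ 4) ?nnegrE ?exprn_ge0 //.
  by rewrite t4 -exprM -[ltLHS]invrK ltf_pV2 // posrE // invr_gt0 exprn_gt0.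
have /andP[ht1 ht2] := truncn_itv t0.
(* One unit makes up for rounding down, the other for the factor 2 in [2 ^ k <= 2 * M]. *)
pose k := (Num.truncn t).+2.
have kt1 : t + 1 <= k%:R by rewrite /k -addn1 natrD lerD2r ltW.
have kt2 : k%:R <= t + 2 by rewrite /k -addn2 natrD lerD2r.
have ek : 432%:R * eps * k%:R ^+ 3 <= 1.
  have -> : eps = (t ^+ 4)^-1 by rewrite t4 invrK.
  have tp : 0 < t ^+ 4 by rewrite exprn_gt0 //; lra.
  rewrite mulrAC ler_pdivrMr // mul1r.
  have : k%:R ^+ 3 <= (2 * t) ^+ 3.
    by rewrite lerXn2r // ?nnegrE //; lra.
  have : 3456%:R * t ^+ 3 <= t * t ^+ 3.
    by rewrite ler_wpM2r // ?exprn_ge0 //; lra.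
  by rewrite exprMn [t ^+ 4]exprS; lra.
have := reg_bound_parts (ltn0Sn _) e0 ek hM.
rewrite /k expnS leq_pmul2l // -(ler_nat R) natrX; apply: le_trans.
by rewrite -powR_mulrn // ler_powR ?ler1n // ltW.
Qed.

(** With [u = eps^-1 > 10], the exponent [K + 4] is at most [3 * u + 5], hence at most [u ^ 2]. *)
Lemma labelled_upper (eps : R) : 0 < eps -> eps < 1 / 10 ->
  exists2 M, reg_bound labelled eps M & M%:R <= 2 `^ (eps `^ (- 2)).
Proof.
move=> e0 esm; pose K := (Num.truncn (3 / eps)).+1.
have e30 : 0 <= 3 / eps by rewrite divr_ge0 // ltW.
have /andP[h1 h2] := truncn_itv e30.
exists (2 ^ (K + 4))%N.
  apply: labelled_reg_bound => //.
  by rewrite mulrC -ler_pdivrMr // ltW.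
rewrite natrX -powR_mulrn // ler_powR ?ler1n //.
rewrite powRN -[2 in leRHS]/(2%:R) powR_mulrn ?ltW // /K natrD -natr1.
have -> : (eps ^+ 2)^-1 = eps^-1 * eps^-1 by rewrite expr2 invfM.
have : 10 < eps^-1 by rewrite -[10]invrK ltf_pV2 // ?posrE ?invr_gt0 //; lra.
set u := eps^-1 in h1 h2 * => u10.
have : 10 * u <= u * u by rewrite ler_wpM2r //; lra.
lra.
Qed.

Theorem theorem6p8 :
  exists H : prop3,
    [/\ hereditary H, SVC_finite H, far_from_finite_VC H &
    exists C C' : R, [/\ 0 < C, 0 < C' &
      exists eps0 : R, 0 < eps0 /\
        forall eps : R, 0 < eps -> eps < eps0 ->
          exists M : nat, [/\ is_MH H eps M,
            2 `^ (eps `^ (- C)) <= M%:R &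
            M%:R <= 2 `^ (eps `^ (- C'))]]].
Proof.
exists labelled; split.
- exact: labelled_hereditary.
- exact: labelled_SVC.
- exact: labelled_far.
exists (1 / 4), 2; split; [lra | lra |].
exists ((10 ^+ 16)^-1); split; first by rewrite invr_gt0 exprn_gt0.
move=> eps e0 esm.
have [|M0 hM0 M0le] := labelled_upper e0.
  apply: lt_trans esm _; rewrite mul1r ltf_pV2 ?posrE ?exprn_gt0 //.
  by rewrite -[ltLHS]expr1 ltr_eXn2l // ltr1n.
have [M [hM Mmin]] := exists_MH hM0; exists M; split=> //.
  exact: labelled_lower.
by apply: le_trans M0le; rewrite ler_nat Mmin.
Qed.
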